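(* Let $G\in\mathbb{RH}_\infty$ and let $0<\alpha<\beta$ be co-prime integers. Define the frequency $\omega:=\frac{\alpha\pi}{\beta}$ and the period $T:=2\beta$ if $\alpha$ is odd, $T:=\beta$ if $\alpha$ is even. If $$\pi-\frac{\pi}{T}\ \le\ \angle G(e^{j\omega})\ \le\ \pi+\frac{\pi}{T},$$ then there exists $\phi\in S_{0,\infty}$ with $0\in\phi(0)$ such that the Lurye system of $G$ and $\phi$ has a non-trivial $T$-periodic solution.
   Context: $j$ is the imaginary unit. $\mathbb{RH}_\infty$ is the space of real rational functions $G(z)$ with all poles inside the open unit disk (in particular proper, with no pole at infinity), i.e. transfer functions of stable, causal, discrete-time, single-input single-output linear time-invariant systems. The impulse response $g_0,g_1,g_2,\dots$ of $G$ is the real sequence with $G(z)=\sum_{k\ge 0} g_k z^{-k}$. For a bounded real input sequence $u=(u_k)_{k\in\mathbb{Z}}$, the output $y=Gu$ is $y_k=\sum_{i=-\infty}^{k} g_{k-i}u_i$, $k\in\mathbb{Z}$. $\angle G(e^{j\omega})$ is the phase (argument) of the complex number $G(e^{j\omega})$, taken modulo $2\pi$; a condition $a\le\angle G(e^{j\omega})\le b$ means $G(e^{j\omega})=\rho e^{j\theta}$ for some $\rho>0$ and $\theta\in[a,b]$. $S_{0,\infty}$ is the set of multivalued functions $\phi$ on $\mathbb{R}$ (assigning to every $y\in\mathbb{R}$ a non-empty set $\phi(y)\subseteq\mathbb{R}$) that are monotone: if $y_2>y_1$, $w_1\in\phi(y_1)$ and $w_2\in\phi(y_2)$, then $w_2\ge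 w_1$. The Lurye system of $G$ and $\phi$ is the negative feedback interconnection $y=Gu$, $u_k=-\phi(y_k)$, which for multivalued $\phi$ means $-u_k\in\phi(y_k)$ for all $k$. A $T$-periodic solution is a pair of real sequences $(u_k)_{k\in\mathbb{Z}},(y_k)_{k\in\mathbb{Z}}$ with $u_{k+T}=u_k$ and $y_{k+T}=y_k$ for all $k$, satisfying $y=Gu$ and $-u_k\in\phi(y_k)$ for all $k\in\mathbb{Z}$; it is non-trivial if it is not identically zero. *)

(* Defs.v *)
From HB Require Import structures.
From mathcomp Require Import all_boot all_order all_algebra fraction.
From mathcomp Require Import all_classical all_reals all_analysis.
From mathcomp Require Import complex.

Set Implicit Arguments.
Unset Strict Implicit.
Unset Printing Implicit Defensive.

Import Order.TTheory GRing.Theory Num.Theory.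
Import numFieldNormedType.Exports.

Local Open Scope classical_set_scope.
Local Open Scope ring_scope.
Local Open Scope complex_scope.

(* [repr G] is an arbitrary representative of the fraction [G]; dividing out
   the gcd gives coprime polynomials, determined by [G] up to a common nonzero
   scalar, so that poles, properness and values below depend on [G] only. *)
Definition ratfun_num (R : realType) (G : {fraction {poly R}}) : {poly R} :=
  (frac (repr G)).1 %/ gcdp (frac (repr G)).1 (frac (repr G)).2.

Definition ratfun_den (R : realType) (G : {fraction {poly R}}) : {poly R} :=
  (frac (repr G)).2 %/ gcdp (frac (repr G)).1 (frac (repr G)).2.

Definition polyC_of_real (R : realType) (p : {poly R}) : {poly R[i]} :=
  map_poly (real_complex R) p.

Definition ratfun_eval (R : realType) (G : {fraction {poly R}}) (z : R[i]) :
    R[i] :=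
  (polyC_of_real (ratfun_num G)).[z] / (polyC_of_real (ratfun_den G)).[z].

Definition ratfun_pole (R : realType) (G : {fraction {poly R}}) (z : R[i]) :
    bool :=
  root (polyC_of_real (ratfun_den G)) z.

(* The size condition says that there is no pole at infinity. *)
Definition RHinf (R : realType) (G : {fraction {poly R}}) : Prop :=
  (size (ratfun_num G) <= size (ratfun_den G))%N /\
  (forall z : R[i], ratfun_pole G z -> `|z| < 1).

(* [g] is the coefficient sequence of the Laurent expansion of [G] at infinity,
   G(z) = \sum_k g_k z^(-k), valid outside the smallest disk centred at 0 that
   contains the poles. The type [R[i]] carries the topology of its norm through
   its [numFieldType] structure. *)
Definition is_impulse_response (R : realType) (G : {fraction {poly R}})
    (g : nat -> R) : Prop :=
  forall z : R[i], z != 0 -> (forall p, ratfun_pole G p -> `|p| < `|z|) ->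
    (fun n => \sum_(0 <= k < n) (g k)%:C * z ^- k : (R[i] : numFieldType))
      @ \oo --> (ratfun_eval G z : (R[i] : numFieldType)).

(* y_k = \sum_(i <= k) g_(k-i) u_i, reindexed by m = k - i. *)
Definition is_output (R : realType) (G : {fraction {poly R}})
    (u y : int -> R) : Prop :=
  exists2 g : nat -> R, is_impulse_response G g &
    forall k : int,
      (fun n => \sum_(0 <= m < n) g m * u (k - m%:Z)) @ \oo --> y k.

Definition expj (R : realType) (theta : R) : R[i] := cos theta +i* sin theta.

Definition phase_between (R : realType) (a b : R) (w : R[i]) : Prop :=
  exists rho theta : R,
    [/\ 0 < rho, a <= theta, theta <= b & w = rho%:C * expj theta].

Definition S0inf (R : realType) (phi : R -> set R) : Prop :=
  (forall y, phi y !=set0) /\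
  (forall y1 y2 w1 w2, y1 < y2 -> phi y1 w1 -> phi y2 w2 -> w1 <= w2).

Definition periodic_seq (R : realType) (T : nat) (u : int -> R) : Prop :=
  forall k : int, u (k + T%:Z) = u k.

Definition lurye_periodic_solution (R : realType) (G : {fraction {poly R}})
    (phi : R -> set R) (T : nat) (u y : int -> R) : Prop :=
  [/\ periodic_seq T u, periodic_seq T y, is_output G u y &
      forall k : int, phi (y k) (- u k)].

Definition nontrivial_solution (R : realType) (u y : int -> R) : Prop :=
  exists k : int, u k != 0 \/ y k != 0.

(* Main.v *)
Require Import Defs.
From mathcomp Require Import all_boot all_order all_algebra fraction.
From mathcomp Require Import all_classical all_reals all_analysis.
From mathcomp Require Import complex.
From mathcomp Require Import ring lra.

Set Implicit Arguments.
Unset Strict Implicit.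
Unset Printing Implicit Defensive.

Import Order.TTheory GRing.Theory Num.Theory.
Import numFieldNormedType.Exports.

Local Open Scope classical_set_scope.
Local Open Scope ring_scope.

(** Put [w = - u], so that [w] must be related to [y = - G w] by a monotone
    relation.  A sampled cosine [w k = cos (omega k)] produces
    [y k = rho cos (omega k + t)], where [t] is the phase of [- G] at
    [expj omega] and [`|t| <= pi / T].  By the product formula, the differences
    of [w] and of [y] between two instants have the signs of [sin X] and
    [sin (X + t)] up to a common factor, with [X] a multiple of [pi / T]; no
    multiple of [pi] lies strictly between [X] and [X + t], because all of them
    are multiples of [pi / T].  Hence the points [(y k, w k)] form a monotone
    set ([sampled_cos_monotone]).

    The origin need not be compatible with this set: when [T] is odd the two
    cosines may have opposite signs at some instant.  Adding a constant to the
    input moves all the points along a line of direction [(kappa, 1)] with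
    [kappa = - G(1)], which amounts to moving the origin along that line.  A
    monotone graph with bounded values meets every such line, by connectedness
    of the real line ([monotone_family_meets_line]), so some constant makes the
    origin compatible.  A bounded monotone set of points extends to a monotone
    multivalued function defined everywhere ([monotone_graph_extends]).

    The impulse response is built from the complex roots of the denominator:
    in [v = z^-1] the function [G] is a polynomial divided by factors
    [1 - p v], and division by each factor is a first-order recurrence on the
    coefficients ([div_geometric_cvg]).  As [G] commutes with conjugation, the
    real parts of these coefficients have the same sum
    ([impulse_response_exists]).  The response to a sampled cosine is then read
    off from the value of the expansion at [expj omega]
    ([offset_cos_output]). *)

(** * Monotone sets of points in the plane *)

(** The lower bound [- M] of the values is put in each set [below y] so that it
    is nonempty even to the left of all points of [A]; its supremum then gives
    a nondecreasing function, to which the points of [A] can be added without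
    breaking monotonicity. *)
Lemma monotone_graph_extends (R : realType) (A : set (R * R)) (M : R) :
  (forall a, A a -> `|a.2| <= M) ->
  (forall a b, A a -> A b -> a.1 < b.1 -> a.2 <= b.2) ->
  exists2 phi : R -> set R, S0inf phi & forall a, A a -> phi a.1 a.2.
Proof.
move=> boundA monoA.
pose below (y : R) : set R := [set w | w = - M \/ exists2 x, x <= y & A (x, w)].
have belowN0 y : below y !=set0 by exists (- M); left.
have below_ub y : ubound (below y) `|M|.
  move=> w [->|[x _ /boundA /= Aw]]; first by rewrite -normrN ler_norm.
  exact: le_trans (ler_norm w) (le_trans Aw (ler_norm M)).
have below_has y : has_ubound (below y) by exists `|M|.
exists (fun y w => A (y, w) \/ w = sup (below y)); last by case=> y w Ayw; left.
split=> [y|y1 y2 w1 w2 y12 h1 h2]; first by exists (sup (below y)); right.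
have w1le : w1 <= sup (below y1).
  case: h1 => [Aw|->] //; apply: ub_le_sup => //.
  by right; exists y1.
apply: le_trans w1le _.
case: h2 => [Aw|->]; apply: ge_sup => // w.
  case=> [->|[x xy1 Axw]].
    by have := boundA _ Aw; rewrite /= ler_norml => /andP[].
  by apply: (monoA _ _ Axw Aw) => /=; exact: le_lt_trans xy1 y12.
case=> [->|[x xy1 Axw]]; apply: ub_le_sup => //; first by left.
by right; exists x => //; exact: ltW (le_lt_trans xy1 y12).
Qed.

(** The two ways in which the point [(kappa * s, s)] can be incompatible with
    the family define two open sets of parameters [s].  Monotonicity makes them
    disjoint, and the bound on [w] excludes that either is everything; they
    cannot cover the connected real line, for any sign of [kappa]. *)
Lemma monotone_family_meets_line (R : realType) (I : Type)
    (y w : I -> R) (kappa M : R) :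
  (forall i, `|w i| <= M) ->
  (forall i j, y i < y j -> w i <= w j) ->
  exists s, forall i, (y i < kappa * s -> w i <= s) /\
                      (kappa * s < y i -> s <= w i).
Proof.
move=> wM mono.
pose low : set R := [set s | exists i, s < w i /\ y i < kappa * s].
pose high : set R := [set s | exists i, w i < s /\ kappa * s < y i].
have lin_cont : continuous (fun s : R => kappa * s).
  by move=> s; apply: cvgM; [exact: cvg_cst | exact: cvg_id].
have low_open : open low.
  rewrite (_ : low = \bigcup_i ([set s | s < w i] `&`
      (fun s => kappa * s) @^-1` [set t | y i < t])).
    apply: bigcup_open => i _; apply: openI; first exact: open_lt.
    by apply: open_comp => [s _|]; [exact: lin_cont | exact: open_gt].
  by apply/seteqP; split=> s /= => [[i h]|[i _ h]]; exists i.
have high_open : open high.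
  rewrite (_ : high = \bigcup_i ([set s | w i < s] `&`
      (fun s => kappa * s) @^-1` [set t | t < y i])).
    apply: bigcup_open => i _; apply: openI; first exact: open_gt.
    by apply: open_comp => [s _|]; [exact: lin_cont | exact: open_lt].
  by apply/seteqP; split=> s /= => [[i h]|[i _ h]]; exists i.
have disj s : low s -> high s -> False.
  move=> [i [swi yi]] [j [wjs yj]].
  by have := mono i j (lt_trans yi yj); rewrite leNgt (lt_trans wjs swi).
have [[s [nlow nhigh]] |cover] := pselect (exists s, ~ low s /\ ~ high s).
  exists s => i; split=> h; rewrite leNgt; apply/negP => hs.
    by apply: nlow; exists i.
  by apply: nhigh; exists i.
exfalso.
have {}cover s : low s \/ high s.
  apply: contrapT => /not_orP h; exact/cover/(ex_intro _ s h).
have high_compl : high = ~` low.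
  apply/seteqP; split=> s => [hs ls|nl]; first exact: disj ls hs.
  by case: (cover s).
have high_big : high (M + 1).
  case: (cover (M + 1)) => // -[i [h _]].
  by have := wM i; rewrite ler_norml => /andP[_]; lra.
have low_small : low (- M - 1).
  case: (cover (- M - 1)) => // -[i [h _]].
  by have := wM i; rewrite ler_norml => /andP[]; lra.
have conn : connected [set: R] by apply/connected_intervalP.
have lowT : low = setT.
  apply: conn; first by exists (- M - 1).
    by exists low; rewrite ?setTI.
  exists low; rewrite ?setTI //.
  by rewrite -[low]setCK -high_compl; exact: open_closedC.
by apply: (disj (M + 1)) => //; rewrite lowT.
Qed.

(** * Monotonicity of sampled cosines *)

Lemma sinD_natpi (R : realType) (n : nat) (x : R) :
  sin (x + n%:R * pi) = (-1) ^+ n * sin x.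
Proof.
elim: n => [|n IHn]; first by rewrite mul0r addr0 mul1r.
by rewrite -natr1 mulrDl mul1r addrA sinDpi IHn exprS mulN1r mulNr.
Qed.

Lemma cosD_nat2pi (R : realType) (n : nat) (x : R) :
  cos (x + n%:R * (pi *+ 2)) = cos x.
Proof.
elim: n => [|n IHn]; first by rewrite mul0r addr0.
by rewrite -natr1 mulrDl mul1r addrA cosD2pi.
Qed.

(** Reducing [j] modulo [T] changes both sines by the same sign.  The remaining
    angle is either [0] or in [[pi / T, pi - pi / T]], and a shift by at most
    [pi / T] cannot leave [[0, pi]]. *)
Lemma sin_mul_sin_shift_ge0_nat (R : realType) (T : nat) (j : nat) (t : R) :
  (0 < T)%N -> `|t| <= pi / T%:R ->
  0 <= sin (j%:R * pi / T%:R) * sin (j%:R * pi / T%:R + t).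
Proof.
move=> T0; rewrite ler_norml => /andP[t1 t2].
have TR : 0 < T%:R :> R by rewrite ltr0n.
have pi0 : 0 < pi :> R by exact: pi_gt0.
set r := (j %% T)%N; set q := (j %/ T)%N.
have -> : j%:R * pi / T%:R = r%:R * (pi / T%:R) + q%:R * pi :> R.
  rewrite {1}(divn_eq j T) natrD natrM -/q -/r.
  by field; rewrite gt_eqF.
rewrite addrAC !sinD_natpi mulrACA -expr2 sqrr_sign mul1r.
have [->|r0] := posnP r; first by rewrite mul0r sin0 mul0r.
have rT : (r < T)%N by rewrite ltn_mod.
set e := pi / T%:R in t1 t2 *.
have e0 : 0 < e by rewrite divr_gt0.
have eT : T%:R * e = pi by rewrite /e mulrCA mulfV ?mulr1 // gt_eqF.
have re1 : e <= r%:R * e by rewrite ler_peMl ?(ltW e0) // ler1n.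
have re2 : r%:R * e <= pi - e.
  rewrite -eT -[X in _ - X]mul1r -mulrBl ler_pM2r // lerBrDr.
  by rewrite natr1 ler_nat.
by apply: mulr_ge0; apply: sin_ge0_pi; apply/andP; split; lra.
Qed.

Lemma sin_mul_sin_shift_ge0 (R : realType) (T : nat) (j : int) (t : R) :
  (0 < T)%N -> `|t| <= pi / T%:R ->
  0 <= sin (j%:~R * pi / T%:R) * sin (j%:~R * pi / T%:R + t).
Proof.
move=> T0 ht; case: (intP j) => [|n|n].
- by rewrite !mul0r sin0 mul0r.
- exact: (@sin_mul_sin_shift_ge0_nat R T n.+1 t).
rewrite rmorphN !mulNr sinN -[_ + t]opprK opprD opprK sinN mulrNN.
by apply: (@sin_mul_sin_shift_ge0_nat R T n.+1 (- t)); rewrite ?normrN.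
Qed.

Lemma cosB_prod (R : realType) (a b : R) :
  cos (a + b) - cos (a - b) = - (2 * sin a * sin b).
Proof. by rewrite cosD cosB; ring. Qed.

(** With [X] and [Y] the half sum and half difference of two angles, the
    differences of the cosines before and after the shift are
    [- 2 sin X sin Y] and [- 2 sin (X + t) sin Y].  A sampling frequency
    [a * 2 pi / T] makes [X] a multiple of [pi / T]. *)
Lemma sampled_cos_monotone (R : realType) (T : nat) (a : int) (rho t : R)
    (k l : int) :
  (0 < T)%N -> 0 < rho -> `|t| <= pi / T%:R ->
  let omega := a%:~R * (pi *+ 2) / T%:R in
  rho * cos (omega * k%:~R + t) < rho * cos (omega * l%:~R + t) ->
  cos (omega * k%:~R) <= cos (omega * l%:~R).
Proof.
move=> T0 rho0 ht omega; rewrite ltr_pM2l // => hlt.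
rewrite leNgt; apply/negP => hgt.
pose X : R := (a * (k + l))%:~R * pi / T%:R.
pose Y : R := omega * (l%:~R - k%:~R) / 2.
have TR : T%:R != 0 :> R by rewrite pnatr_eq0 -lt0n.
have XE : X = omega * (k%:~R + l%:~R) / 2.
  by rewrite /X /omega rmorphM rmorphD /=; field.
have pos := sin_mul_sin_shift_ge0 (a * (k + l)) T0 ht.
rewrite -/X in pos.
have := cosB_prod X Y.
have -> : X + Y = omega * l%:~R by rewrite XE /Y; field.
have -> : X - Y = omega * k%:~R by rewrite XE /Y; field.
have := cosB_prod (X + t) Y.
have -> : X + t + Y = omega * l%:~R + t by rewrite XE /Y; field.
have -> : X + t - Y = omega * k%:~R + t by rewrite XE /Y; field.
move=> e1 e2.
have p1 : 0 < - (2 * sin (X + t) * sin Y) by rewrite -e1 subr_gt0.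
have p2 : 0 < 2 * sin X * sin Y by rewrite -oppr_lt0 -e2 subr_lt0.
have := mulr_gt0 p1 p2.
rewrite (_ : _ * _ = - (sin X * sin (X + t)) * (2 * sin Y) ^+ 2); last by ring.
by rewrite ltNge mulNr oppr_le0 mulr_ge0 ?sqr_ge0.
Qed.

(** * Convergence of expansions in powers of [z^-1] *)

(** Unrolling the recurrence from a rank [N] beyond which [e] is small bounds
    [c] by a geometric tail plus [eps / 2]. *)
Lemma contraction_cvg0 (R : realType) (c e : nat -> R) (r : R) :
  0 <= r -> r < 1 -> (forall n, 0 <= c n) ->
  (forall n, c n.+1 <= r * c n + e n) ->
  e @ \oo --> (0 : R) -> c @ \oo --> (0 : R).
Proof.
move=> r0 r1 c0 cS /cvgr0Pnorm_le e_small.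
apply/cvgr0Pnorm_le => eps eps0.
have d0 : 0 < (1 - r) * (eps / 2) by rewrite mulr_gt0 ?subr_gt0 ?divr_gt0.
have [N _ eN] := e_small _ d0.
have cN k : c (N + k)%N <= r ^+ k * c N + eps / 2.
  elim: k => [|k IHk]; first by rewrite addn0 mul1r lerDl ltW // divr_gt0.
  rewrite addnS; apply: le_trans (cS _) _.
  have ee : e (N + k)%N <= (1 - r) * (eps / 2).
    by apply: le_trans (ler_norm _) (eN _ _); rewrite /= leq_addr.
  rewrite exprS -mulrA.
  have := ler_wpM2l r0 IHk; lra.
have geom0 : (fun k => r ^+ k * c N) @ \oo --> (0 : R).
  rewrite -(mul0r (c N)); apply: cvgM; last exact: cvg_cst.
  by apply: cvg_expr; rewrite ger0_norm.
have [K _ hK] := (iffLR (cvgr0Pnorm_le _) geom0) _ (divr_gt0 eps0 (ltr0n R 2)).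
exists (N + K)%N => // n /= hn.
rewrite ger0_norm // -(subnKC (leq_trans (leq_addr K N) hn)).
apply: le_trans (cN _) _.
have := hK (n - N)%N; rewrite /= leq_subRL ?(leq_trans (leq_addr K N) hn) //.
move=> /(_ hn) h.
have := le_trans (ler_norm _) h; lra.
Qed.

Section ComplexSeries.
Variable R : realType.
Local Notation C := (R[i] : numFieldType).

Lemma normc_ge0 (z : C) : 0 <= Normc.normc z.
Proof. by case: z => a b; exact: sqrtr_ge0. Qed.

(** The norm of [R[i]] takes its values in [R[i]]; this brings convergence back
    to a statement on real sequences. *)
Lemma cvgC_normc (f : nat -> C) (l : C) :
  f @ \oo --> l <->
  (fun n => Normc.normc (f n - l)) @ \oo --> (0 : R).
Proof.
split.
- move=> /cvgrPdist_le h; apply/cvgr0Pnorm_le => eps eps0.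
  have : 0 < eps%:C%C :> C by rewrite ltcR.
  move=> /h [N _ hN]; exists N => // n /= /hN /=.
  rewrite (ger0_norm (normc_ge0 _)).
  by rewrite distrC -lecR; apply.
- move=> /cvgr0Pnorm_le h; apply/cvgrPdist_le => eps eps0.
  have epsE : eps = (complex.Re eps)%:C%C by rewrite RRe_real // gtr0_real.
  have : 0 < complex.Re eps by rewrite -ltcR -epsE.
  move=> /h [N _ hN]; exists N => // n /= /hN /=.
  rewrite (ger0_norm (normc_ge0 _)).
  by rewrite -lecR -epsE distrC.
Qed.

Lemma cvg_Re (f : nat -> C) (l : C) :
  f @ \oo --> l -> (fun n => complex.Re (f n)) @ \oo --> complex.Re l.
Proof.
move=> /cvgC_normc /cvgr0Pnorm_le h; apply/cvgrPdist_le => eps /h [N _ hN].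
exists N => // n /= /hN /= hn.
rewrite distrC -raddfB /= -lecR.
apply: le_trans (normc_ge_Re _) _.
by rewrite lecR; exact: le_trans (ler_norm _) hn.
Qed.

Lemma cvg_conjc (f : nat -> C) (l : C) :
  f @ \oo --> l -> (fun n => conjc (f n) : C) @ \oo --> (conjc l : C).
Proof.
move=> /cvgC_normc h; apply/cvgC_normc; apply: cvg_trans h.
apply: near_eq_cvg; near=> n.
by rewrite -raddfB; case: (f n - l) => a b /=; rewrite sqrrN.
Unshelve. all: by end_near. Qed.

(** Coefficients of [a(v) / (1 - p v)] for the power series [a]. *)
Fixpoint div_geometric (p : C) (a : nat -> C) (n : nat) : C :=
  if n is m.+1 then p * div_geometric p a m + a n else a 0%N.

(** Multiplying a partial sum of the quotient by [1 - p v] gives the partial sum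
    of [a] up to one boundary term, which tends to [0] as the solution of the
    recurrence [c n.+1 = p v c n + o(1)] with [`|p v| < 1]. *)
Lemma div_geometric_cvg (p v A : C) (a : nat -> C) :
  `|p * v| < 1 ->
  (fun n => \sum_(0 <= k < n) a k * v ^+ k : C) @ \oo --> A ->
  (fun n => \sum_(0 <= k < n) div_geometric p a k * v ^+ k : C) @ \oo -->
    (A / (1 - p * v) : C).
Proof.
move=> pv1 cvA; set b := div_geometric p a.
have bE0 : b 0%N = a 0%N by [].
have bS n : b n.+1 = p * b n + a n.+1 by [].
have nz : 1 - p * v != 0.
  by apply: contraTneq pv1 => /eqP; rewrite subr_eq0 => /eqP <-; rewrite normr1 ltxx.
have a0 : (fun n => a n * v ^+ n) @ \oo --> (0 : C).
  by apply: cvg_series_cvg_0; apply/cvg_ex; exists A.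
have b0 : (fun n => b n * v ^+ n) @ \oo --> (0 : C).
  apply/cvgC_normc.
  apply: (@contraction_cvg0 _ _ (fun n => Normc.normc (a n.+1 * v ^+ n.+1))
            (Normc.normc (p * v))).
  - exact: normc_ge0.
  - by rewrite -ltcR.
  - by move=> n; exact: normc_ge0.
  - move=> n; rewrite !subr0 -Normc.normcM.
    rewrite (_ : b n.+1 * v ^+ n.+1 =
       p * v * (b n * v ^+ n) + a n.+1 * v ^+ n.+1).
      exact: le_normcD.
    by rewrite bS exprS; ring.
  - have := a0; rewrite -cvg_shiftS => /cvgC_normc.
    by under eq_fun do rewrite subr0.
have pvb0 : (fun n => p * v * (b n * v ^+ n)) @ \oo --> (0 : C).
  rewrite -[X in _ --> X](mulr0 (p * v)).
  by apply: cvgM; [exact: cvg_cst | exact: b0].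
have sumE n : \sum_(0 <= k < n.+1) b k * v ^+ k =
    ((\sum_(0 <= k < n.+1) a k * v ^+ k) - p * v * (b n * v ^+ n))
       / (1 - p * v).
  apply: (canRL (mulfK nz)).
  elim: n => [|n IHn]; first by rewrite !big_nat1 bE0; ring.
  rewrite big_nat_recr // mulrDl IHn [in RHS]big_nat_recr // bS exprS
    -[RHS]/(_ + _ - _).
  by ring.
rewrite -cvg_shiftS /=.
under eq_fun do rewrite sumE.
apply: cvgM; last exact: cvg_cst.
rewrite -[A]subr0; apply: cvgB; first by move: cvA; rewrite -cvg_shiftS.
exact: pvb0.
Qed.

Lemma foldr_div_geometric_cvg (v A : C) (a : nat -> C) (s : seq C) :
  (forall p, p \in s -> `|p * v| < 1) ->
  (fun n => \sum_(0 <= k < n) a k * v ^+ k : C) @ \oo --> A ->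
  (fun n => \sum_(0 <= k < n) foldr div_geometric a s k * v ^+ k : C) @ \oo -->
    (A / \prod_(p <- s) (1 - p * v) : C).
Proof.
elim: s => [|p s IHs] hs cvA; first by rewrite big_nil divr1.
rewrite big_cons invfM mulrCA mulrC [foldr _ _ _]/=.
apply: div_geometric_cvg; first by apply: hs; rewrite mem_head.
by apply: IHs => // q qs; apply: hs; rewrite inE qs orbT.
Qed.

(** The value of [N] divided by [z ^+ m] is a polynomial in [z^-1], whose
    coefficients are those of [N] in reverse order. *)
Lemma reversed_poly_cvg (N : {poly C}) (m : nat) (d z : C) :
  (size N <= m.+1)%N -> z != 0 ->
  (fun n => \sum_(0 <= k < n)
     (if (k <= m)%N then N`_(m - k) / d else 0) * z^-1 ^+ k : C) @ \oo -->
    (N.[z] / (d * z ^+ m) : C).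
Proof.
move=> sN z0; pose F k : C := (if (k <= m)%N then N`_(m - k) / d else 0) * z^-1 ^+ k.
have sumE n : \sum_(0 <= k < n + m.+1) F k = N.[z] / (d * z ^+ m).
  rewrite (@big_cat_nat _ _ _ m.+1) //= ?leq_addl //.
  rewrite [X in _ + X]big1_seq ?addr0; last first.
    move=> k /=; rewrite mem_index_iota /F => /andP[mk _].
    by rewrite leqNgt mk mul0r.
  rewrite big_nat_rev /= (horner_coef_wide _ sN) mulr_suml big_mkord.
  apply: eq_bigr => i _; have im : (i <= m)%N by rewrite -ltnS.
  rewrite /F add0n subSS leq_subr subKn // invfM.
  have -> : z ^+ m = z ^+ (m - i) * z ^+ i by rewrite -exprD subnK.
  rewrite exprVn; set d' := d^-1.
  by field; rewrite !expf_neq0.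
rewrite -(cvg_shiftn m.+1).
rewrite (_ : (fun n => _) = cst (N.[z] / (d * z ^+ m))); first exact: cvg_cst.
by apply/funext => n; exact: sumE.
Qed.

End ComplexSeries.

(** * Impulse response and sampled cosine inputs *)

Section ImpulseResponse.
Variable R : realType.
Local Notation C := (R[i] : numFieldType).

Lemma ratfun_den_neq0 (G : {fraction {poly R}}) : ratfun_den G != 0.
Proof.
rewrite /ratfun_den; set x := frac (repr G).
have d0 : x.2 != 0 by exact: denom_ratioP.
apply: contraNneq d0 => q0.
by rewrite -(divpK (dvdp_gcdr x.1 x.2)) q0 mul0r.
Qed.

Lemma ratfun_eval_conjc (G : {fraction {poly R}}) (z : R[i]) :
  conjc (ratfun_eval G (conjc z)) = ratfun_eval G z.
Proof.
have conj_real (p : {poly R}) :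
    conjc (polyC_of_real p).[conjc z] = (polyC_of_real p).[z].
  rewrite -horner_map /= conjcK /polyC_of_real -map_poly_comp.
  by congr (_.[_]); apply: eq_map_poly => x; exact: conjc_real.
by rewrite /ratfun_eval rmorphM fmorphV /= !conj_real.
Qed.

Lemma prod_XsubC_reverse (z : C) (s : seq C) : z != 0 ->
  \prod_(p <- s) (z - p) = z ^+ size s * \prod_(p <- s) (1 - p * z^-1).
Proof.
move=> z0; elim: s => [|p s IHs]; first by rewrite !big_nil mulr1.
by rewrite !big_cons IHs /= exprS; field.
Qed.

(** Over the algebraically closed field [R[i]] the denominator of degree [m] is
    [d z^m] times the product of [1 - p z^-1] over its roots, so the expansion
    of the reversed numerator, divided by these factors in turn, works wherever
    [z] dominates all poles. *)
Lemma complex_expansion_exists (G : {fraction {poly R}}) :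
  (size (ratfun_num G) <= size (ratfun_den G))%N ->
  exists b : nat -> C, forall z : C, z != 0 ->
    (forall p, ratfun_pole G p -> `|p| < `|z|) ->
    (fun n => \sum_(0 <= k < n) b k * z^-1 ^+ k : C) @ \oo -->
      (ratfun_eval G z : C).
Proof.
move=> proper; pose N := polyC_of_real (ratfun_num G).
pose D := polyC_of_real (ratfun_den G).
have [s Ds] := closed_field_poly_normal D; set d := lead_coef D in Ds.
have d0 : d != 0.
  by rewrite lead_coef_eq0 map_poly_eq0 ratfun_den_neq0.
have sizeD : size D = (size s).+1 by rewrite Ds size_scale // size_prod_XsubC.
have sizeN : (size N <= (size s).+1)%N.
  by rewrite -sizeD /N /D /polyC_of_real !size_map_poly.
exists (foldr (@div_geometric R)
          (fun k => if (k <= size s)%N then N`_(size s - k) / d else 0) s).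
move=> z z0 zout.
have -> : ratfun_eval G z =
    N.[z] / (d * z ^+ size s) / \prod_(p <- s) (1 - p * z^-1).
  rewrite /ratfun_eval -/N -/D {1}Ds hornerZ horner_prod.
  under eq_bigr do rewrite hornerXsubC.
  by rewrite prod_XsubC_reverse // mulrA invfM mulrA.
apply: foldr_div_geometric_cvg; last exact: reversed_poly_cvg.
move=> p ps; rewrite normrM normfV ltr_pdivrMr ?normr_gt0 // mul1r.
by apply: zout; rewrite /ratfun_pole -/D Ds rootZ // root_prod_XsubC.
Qed.

(** The expansion at [conjc z], conjugated, is an expansion of [G] at [z] with
    conjugate coefficients; the average of the two has the real parts as
    coefficients. *)
Lemma impulse_response_exists (G : {fraction {poly R}}) :
  (size (ratfun_num G) <= size (ratfun_den G))%N ->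
  exists g, is_impulse_response G g.
Proof.
move=> /complex_expansion_exists [b bG].
exists (fun k => complex.Re (b k)) => z z0 zout.
have cvz := bG z z0 zout.
have zc0 : conjc z != 0 by rewrite conjc_eq0.
have zcout p : ratfun_pole G p -> `|p| < `|conjc z| by rewrite normcJ; exact: zout.
have cvzc := cvg_conjc (bG (conjc z) zc0 zcout).
rewrite ratfun_eval_conjc in cvzc.
have two0 : (2 : C) != 0 by rewrite pnatr_eq0.
rewrite (_ : ratfun_eval G z = (ratfun_eval G z + ratfun_eval G z) / 2); last first.
  by rewrite -mulr2n -[_ *+ 2]mulr_natr mulfK.
rewrite (_ : (fun n => _) = (fun n =>
   ((\sum_(0 <= k < n) b k * z^-1 ^+ k) +
    conjc (\sum_(0 <= k < n) b k * (conjc z)^-1 ^+ k)) / 2)).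
  by apply: cvgM; [exact: cvgD | exact: cvg_cst].
apply/funext => n.
rewrite rmorph_sum -big_split mulr_suml; apply: eq_bigr => k _ /=.
rewrite rmorphM rmorphXn fmorphV /= conjcK ReJ_add exprVn.
by rewrite -mulrDl mulrAC.
Qed.

Lemma expjD (a b : R) : expj (a + b) = expj a * expj b.
Proof.
rewrite /expj cosD sinD; apply/eqP; rewrite eq_complex /=.
by rewrite eqxx addrC [sin a * _]mulrC eqxx.
Qed.

Lemma expj_natX (omega : R) (n : nat) : expj (n%:R * omega) = expj omega ^+ n.
Proof.
elim: n => [|n IHn]; first by rewrite mul0r /expj cos0 sin0.
by rewrite -natr1 mulrDl mul1r expjD IHn exprSr.
Qed.

Lemma normr_expj (t : R) : `|expj t| = 1.
Proof. by rewrite normc_def /= cos2Dsin2 sqrtr1. Qed.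

Lemma expj_neq0 (t : R) : expj t != 0.
Proof. by rewrite -normr_eq0 normr_expj oner_eq0. Qed.

(** Exponential inputs are eigenvectors: on partial sums, the response to
    [expj (omega k)] is [expj (omega k)] times a partial sum of the expansion
    of [G] at [expj omega], and a constant input is the case of frequency [0].
    Taking real parts gives the limit. *)
Lemma offset_cos_output (G : {fraction {poly R}}) (g : nat -> R)
    (omega s : R) (k : int) :
  (forall z : R[i], ratfun_pole G z -> `|z| < 1) ->
  is_impulse_response G g ->
  (fun n => \sum_(0 <= m < n) g m * (s - cos (omega * (k - m%:Z)%:~R))) @ \oo
    --> s * complex.Re (ratfun_eval G 1)
        - complex.Re (expj (omega * k%:~R) * ratfun_eval G (expj omega)).
Proof.
move=> stable gG.
have cv1 := gG 1 (oner_neq0 _).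
have cvw := gG (expj omega) (expj_neq0 _).
rewrite normr1 in cv1; rewrite normr_expj in cvw.
have {}cv1 := cv1 stable; have {}cvw := cvw stable.
have cv : (fun n => s%:C%C * (\sum_(0 <= m < n) (g m)%:C%C * 1 ^- m)
     - expj (omega * k%:~R) * (\sum_(0 <= m < n) (g m)%:C%C * expj omega ^- m) : C)
  @ \oo --> (s%:C%C * ratfun_eval G 1
     - expj (omega * k%:~R) * ratfun_eval G (expj omega) : C).
  by apply: cvgB; apply: cvgM; [exact: cvg_cst | exact: cv1
                             | exact: cvg_cst | exact: cvw].
have := cvg_Re cv.
rewrite (_ : complex.Re _ = s * complex.Re (ratfun_eval G 1)
        - complex.Re (expj (omega * k%:~R) * ratfun_eval G (expj omega))); last first.
  rewrite raddfB /=; congr (_ - _).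
  by case: (ratfun_eval G 1) => x y /=; rewrite mul0r subr0.
rewrite (_ : (fun n => complex.Re _) = (fun n =>
   \sum_(0 <= m < n) g m * (s - cos (omega * (k - m%:Z)%:~R)))) //.
apply/funext => n.
rewrite !mulr_sumr -sumrB raddf_sum; apply: eq_bigr => m _.
rewrite expr1n invr1 mulr1.
rewrite (_ : _ - _ = (g m)%:C%C * (s%:C%C - expj (omega * (k - m%:Z)%:~R))).
  by rewrite /expj /=; ring.
have -> : expj (omega * (k - m%:Z)%:~R) =
    expj (omega * k%:~R) * (expj omega ^- m).
  apply: (canRL (mulfK (expf_neq0 _ (expj_neq0 _)))).
  rewrite -expj_natX -expjD rmorphB /=; congr expj.
  by ring.
by ring.
Qed.

End ImpulseResponse.

Theorem theorem1 (R : realType) (G : {fraction {poly R}}) (hG : RHinf G)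
    (alpha beta : nat) (halpha : (0 < alpha)%N) (hbeta : (alpha < beta)%N)
    (hcop : coprime alpha beta) :
  let omega : R := alpha%:R * pi / beta%:R in
  let T : nat := if odd alpha then (2 * beta)%N else beta in
  phase_between (pi - pi / T%:R) (pi + pi / T%:R)
    (ratfun_eval G (expj omega)) ->
  exists phi : R -> set R,
    [/\ S0inf phi, phi 0 0 &
      exists u y : int -> R,
        lurye_periodic_solution G phi T u y /\ nontrivial_solution u y].
Proof.
move=> omega T [rho [theta [rho0 th1 th2 GE]]].
case: hG => proper stable.
have beta0 : (0 < beta)%N by exact: leq_ltn_trans hbeta.
have betaR : beta%:R != 0 :> R by rewrite pnatr_eq0 -lt0n.
have T0 : (0 < T)%N by rewrite /T; case: ifP => _ //; rewrite muln_gt0.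
have TR : T%:R != 0 :> R by rewrite pnatr_eq0 -lt0n.
(* Parity decides whether the sampling angle is a multiple of [2 pi / beta] or
   only of [pi / beta]; [T] is the matching denominator. *)
have [a omegaE] : exists a : nat, omega = a%:R * (pi *+ 2) / T%:R.
  rewrite /omega /T; case: ifPn => [_|ev].
    exists alpha; rewrite natrM -mulr_natr; field.
    by rewrite betaR.
  exists alpha./2; rewrite -[in LHS](odd_double_half alpha) (negbTE ev) add0n.
  by rewrite -mul2n natrM -mulr_natr; field.
have omegaT : omega * T%:R = a%:R * (pi *+ 2) by rewrite omegaE mulfVK.
pose t := theta - pi.
have ht : `|t| <= pi / T%:R by rewrite ler_norml; apply/andP; split; rewrite /t; lra.
pose w (k : int) : R := cos (omega * k%:~R).
pose y (k : int) : R := rho * cos (omega * k%:~R + t).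
pose kappa : R := - complex.Re (ratfun_eval G 1).
have mono k l : y k < y l -> w k <= w l.
  by rewrite /y /w omegaE; exact: (@sampled_cos_monotone R T a).
have wM k : `|w k| <= 1 by exact: cos_max.
(* [s] is the offset that brings the origin into the monotone graph. *)
have [s hs] := monotone_family_meets_line kappa wM mono.
pose A : set (R * R) :=
  [set p | p = (0, 0) \/ exists k, p = (y k - kappa * s, w k - s)].
have A_bounded p : A p -> `|p.2| <= 1 + `|s|.
  case=> [->|[k ->]] /=; first by rewrite normr0 addr_ge0.
  by apply: le_trans (ler_normB _ _) _; rewrite lerD2r.
have A_mono p q : A p -> A q -> p.1 < q.1 -> p.2 <= q.2.
  case=> [->|[k ->]] [->|[l ->]] /=.
  - by rewrite ltxx.
  - by rewrite subr_gt0 subr_ge0; exact: (hs l).2.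
  - by rewrite subr_lt0 subr_le0; exact: (hs k).1.
  - by rewrite ltrD2r lerD2r; exact: mono.
have [phi phiS phiA] := monotone_graph_extends A_bounded A_mono.
have periodic (c : R) k :
    cos (omega * (k + T%:Z)%:~R + c) = cos (omega * k%:~R + c).
  rewrite rmorphD /= mulrDr -[T%:~R]/(T%:R) omegaT addrAC.
  exact: cosD_nat2pi.
exists phi; split=> //; first by apply: (phiA (0, 0)); left.
exists (fun k => s - w k), (fun k => y k - kappa * s); split; last first.
  (* If [u] vanished, [w] would be constant, but [cos omega < cos 0]. *)
  apply: contrapT => triv.
  have w_const k : w k = s.
    apply/eqP; rewrite eq_sym -subr_eq0; apply: contrapT => /negP uk.
    by apply: triv; exists k; left.
  have : cos omega = cos 0
    by rewrite -[omega]mulr1 -(mulr0 omega) -/(w 1) -/(w 0) !w_const.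
  have beta_pos : 0 < beta%:R :> R by rewrite ltr0n.
  have omega0 : 0 < omega.
    by rewrite /omega divr_gt0 // mulr_gt0 ?pi_gt0 // ltr0n.
  have omega_pi : omega <= pi.
    rewrite /omega ler_pdivrMr // mulrC ler_pM2l ?pi_gt0 //.
    by rewrite ler_nat ltnW.
  move/cos_inj; rewrite !in_itv /= (ltW omega0) omega_pi lexx pi_ge0.
  by move=> /(_ isT isT) omega_eq0; rewrite omega_eq0 ltxx in omega0.
split.
- by move=> k; congr (s - _); have := periodic 0 k; rewrite !addr0.
- by move=> k; rewrite /y periodic.
- have [g gG] := impulse_response_exists proper.
  exists g => // k.
  have := offset_cos_output (omega := omega) (s := s) (k := k) stable gG.
  rewrite (_ : _ - complex.Re _ = y k - kappa * s) //.
  rewrite GE mulrCA -expjD /y /kappa.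
  have -> : omega * k%:~R + theta = omega * k%:~R + t + pi by rewrite /t; ring.
  by rewrite /expj cosDpi /=; ring.
- by move=> k; rewrite opprB; apply: (phiA (_, _)); right; exists k.
Qed.
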